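(* Assume that $g$ is Lipschitz-continuous with a constant $\ell_g>0$ and that the stabilization parameter satisfies $\kappa\ge2\ell_g$. Let $\tau>0$. Consider the three-stage scheme ($s=3$) $$U^{n,i+1}=U^{n,1}+\sum_{j=1}^{i}\hat a_{i+1,j}(-\tau L_\kappa)\big[\tau g_\kappa(U^{n,j})-\tau L_\kappa U^{n,1}\big],\quad 1\le i\le 3,\qquad U^{n,1}=u_h^{n-1},\ u_h^n=U^{n,4},\ n\ge1,$$ with coefficient matrix $\widehat A(z)=[\hat a_{i+1,j}(z)]_{i,j=1}^3$ given by either of (TIF3-Ralston) $$\widehat A(z)=\begin{pmatrix}\frac1{2-z}&0&0\\ 0&\frac{3}{4e^{z/2}-3z}&0\\ \frac{2e^{3z/4}}{q(z)}&\frac{3e^{z/4}}{q(z)}&\frac{4}{q(z)}\end{pmatrix},\qquad q(z):=e^{3z/4}(9-2z)-3e^{z/4}z-4z,$$ (NIF3-Ralston) $$\widehat A(z)=\begin{pmatrix}\frac{e^{z/2}-1}{z}&0&0\\ 0&\frac{e^{3z/4}-1}{z}&0\\ \frac{2e^z}9&\frac{e^{z/2}}3&\frac{e^z-1}{z}-\frac{e^{z/2}}3-\frac{2e^z}9\end{pmatrix}.$$ Then both the TIF3-Ralston and the NIF3-Ralston schemes preserve the original energy dissipation law at all stages (in the sense defined in the context).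
   Context: Setting: $L_h$ is a symmetric positive definite real $M\times M$ matrix (a spatial discretization of a stiff linear operator). $G$ is a non-negative differentiable (Lyapunov) function and $g(v)=-\frac{\delta}{\delta v}G(v)$, i.e. $g=-G'$; both $G$ and $g$ act componentwise on vectors in $\mathbb{R}^M$. The inner product is $\langle u,v\rangle:=v^Tu$. The original energy is $E[u]:=\frac12\langle u,L_hu\rangle+\langle G(u),1\rangle$, where $1$ is the all-ones vector; the problem $u_h'+L_hu_h=g(u_h)$ is the gradient flow $\frac{du_h}{dt}=-\frac{\delta E}{\delta u_h}$, with $\frac{dE}{dt}=-\langle\frac{du_h}{dt},\frac{du_h}{dt}\rangle\le0$. For $\kappa\ge0$ put $L_\kappa:=L_h+\kappa I$, $g_\kappa(u):=\kappa u+g(u)$, so the gradient flow is equivalently $u_h'=-L_\kappa u_h+g_\kappa(u_h)$. Functions $f(-\tau L_\kappa)$ are matrix functions of the symmetric matrix $-\tau L_\kappa$ (spectrum in $(-\infty,0)$). Differentiation matrix: for an $s$-stage scheme of the displayed form, let $\widehat A(z):=[\hat a_{i+1,j}(z)]_{i,j=1}^s$ (lower triangular, with zero entries for $j>i$), $E_s:=(1_{i\ge j})_{s\times s}$ the lower triangular all-ones matrix, $I$ the identity, and $$D(z):=\widehat A(z)^{-1}E_s+zE_s-\frac z2I .$$ $D_j(z):=D[1:j,1:j]$ is its $j$-th leading principal submatrix, and $D_j(-\tau L_\kappa)$ is the $j\times j$ block matrix obtained by replacing each scalar entry $d_{k\ell}(z)$ with the matrix $d_{k\ell}(-\tau L_\kappa)$.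 Put $\delta_\tau U^{n,\ell+1}:=U^{n,\ell+1}-U^{n,\ell}$ and $\delta_\tau\vec U_{n,j+1}:=(\delta_\tau U^{n,2},\dots,\delta_\tau U^{n,j+1})^T$. The scheme ''preserves the original energy dissipation law at all stages'' means: for all $n\ge1$ and $1\le j\le s$, $$E[U^{n,j+1}]-E[U^{n,1}]\le-\frac1\tau\big\langle\delta_\tau\vec U_{n,j+1},\,D_j(-\tau L_\kappa)\,\delta_\tau\vec U_{n,j+1}\big\rangle\le 0,$$ where the inner product of block vectors is the sum of the inner products of the blocks; in particular $E[U^{n,j+1}]\le E[U^{n,1}]$. *)

(* Defs.v *)
From HB Require Import structures.
From mathcomp Require Import all_boot all_order all_algebra.
From mathcomp Require Import all_classical all_reals all_analysis.

Set Implicit Arguments.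
Unset Strict Implicit.
Unset Printing Implicit Defensive.

Import Order.TTheory GRing.Theory Num.Theory.
Import numFieldNormedType.Exports.
Local Open Scope classical_set_scope.
Local Open Scope ring_scope.

Definition inner (R : realType) (m : nat) (u v : 'cV[R]_m) : R :=
  (v^T *m u) ord0 ord0.

Definition spd (R : realType) (m : nat) (L : 'M[R]_m) : Prop :=
  L \is symmetricmx /\ forall v : 'cV[R]_m, v != 0 -> 0 < inner v (L *m v).

(* Matrix function f(A) of a diagonalizable matrix A: if A = P^-1 diag(d) P
   then f(A) = P^-1 diag(f(d)) P. By [funmx_diag] this does not depend on the
   diagonalization, and the default value 0 is only used for matrices that are
   not diagonalizable over R (so never for a symmetric one). *)
Definition funmx (R : realType) (m : nat) (f : R -> R) (A : 'M[R]_m) :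
    'M[R]_m :=
  xget 0 [set B | exists (P : 'M[R]_m) (d : 'rV[R]_m),
    [/\ P \in unitmx, A = invmx P *m diag_mx d *m P
      & B = invmx P *m diag_mx (map_mx f d) *m P]].

Lemma funmx_diag (R : realType) (m : nat) (f : R -> R) (P : 'M[R]_m)
    (d : 'rV[R]_m) : P \in unitmx ->
  funmx f (invmx P *m diag_mx d *m P) =
  invmx P *m diag_mx (map_mx f d) *m P.
Proof.
move=> Pu; rewrite /funmx; case: xgetP => [B _ [Q [e [Qu eqA ->]]]|]; last first.
  by move=> /(_ (invmx P *m diag_mx (map_mx f d) *m P)) []; exists P, d.
pose S := Q *m invmx P.
have SdeS : S *m diag_mx d = diag_mx e *m S.
  apply: (can_inj (mulmxK Pu)); rewrite /S -!mulmxA mulVmx// mulmx1.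
  by rewrite (mulmxA (invmx P)) eqA !mulmxA mulmxV// mul1mx.
have fS : S *m diag_mx (map_mx f d) = diag_mx (map_mx f e) *m S.
  clearbody S; apply/matrixP => i j; move/matrixP/(_ i j): SdeS.
  rewrite !mul_mx_diag !mul_diag_mx !mxE mulrC => eS.
  have [->|S0] := eqVneq (S i j) 0; first by rewrite mul0r mulr0.
  by rewrite (mulIf S0 eS) mulrC.
apply: (can_inj (mulKmx Qu)); rewrite !mulmxA mulmxV// mul1mx.
by rewrite -/S fS /S -!mulmxA mulVmx// mulmx1.
Qed.

Section Scheme.
Variables (R : realType) (M : nat).

Definition energy (Lh : 'M[R]_M) (G : R -> R) (u : 'cV[R]_M) : R :=
  2^-1 * inner u (Lh *m u) + inner (map_mx G u) (const_mx 1).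

Definition Lstab (Lh : 'M[R]_M) (kappa : R) : 'M[R]_M := Lh + kappa%:M.

Definition gstab (g : R -> R) (kappa : R) (u : 'cV[R]_M) : 'cV[R]_M :=
  kappa *: u + map_mx g u.

(* [U n i] is the stage U^{n,i} (1 <= i <= s+1, n >= 1). The entries of [A z]
   are numbered from 0: [A z i j] is \hat a_{i+2,j+1}(z), so that the ordinal
   [i] stands for the row producing U^{n,i+2}. *)
Definition scheme_solution (s : nat) (A : R -> 'M[R]_s) (Lh : 'M[R]_M)
    (g : R -> R) (kappa tau : R) (uh : nat -> 'cV[R]_M)
    (U : nat -> nat -> 'cV[R]_M) : Prop :=
  let Lk := Lstab Lh kappa in
  forall n : nat, (1 <= n)%N ->
  [/\ U n 1%N = uh n.-1,
      forall i : 'I_s, U n i.+2 = U n 1%N +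
        \sum_(j < s | (j <= i)%N)
          funmx (fun z => A z i j) (- tau *: Lk) *m
            (tau *: gstab g kappa (U n j.+1) - tau *: (Lk *m U n 1%N))
    & uh n = U n s.+1].

Definition Emx (s : nat) : 'M[R]_s :=
  \matrix_(i, j) (if (j <= i)%N then 1 else 0).

Definition diffmx (s : nat) (A : R -> 'M[R]_s) (z : R) : 'M[R]_s :=
  invmx (A z) *m Emx s + z *: Emx s - (z / 2)%:M.

Definition leading (s j : nat) (hj : (j <= s)%N) (B : 'M[R]_s) : 'M[R]_j :=
  mxsub (widen_ord hj) (widen_ord hj) B.

Definition blockfunmx (j : nat) (D : R -> 'M[R]_j) (B : 'M[R]_M) :
    'M[R]_(\sum_(k < j) M) :=
  \mxblock_(k < j, l < j) funmx (fun z => D z k l) B.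

(* The column of blocks V_2 - V_1, ..., V_{j+1} - V_j. *)
Definition increments (j : nat) (V : nat -> 'cV[R]_M) :
    'cV[R]_(\sum_(k < j) M) :=
  \mxcol_(k < j) (V k.+2 - V k.+1).

Definition dissipates_all_stages (s : nat) (A : R -> 'M[R]_s)
    (Lh : 'M[R]_M) (G : R -> R) (kappa tau : R)
    (U : nat -> nat -> 'cV[R]_M) : Prop :=
  forall (n j : nat) (hj : (j <= s)%N), (1 <= n)%N -> (1 <= j)%N ->
  let dU := increments j (U n) in
  let Dj := blockfunmx (fun z => leading hj (diffmx A z))
                       (- tau *: Lstab Lh kappa) in
  energy Lh G (U n j.+1) - energy Lh G (U n 1%N)
    <= - (tau^-1 * inner dU (Dj *m dU)) <= 0.

Definition preserves_dissipation (s : nat) (A : R -> 'M[R]_s)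
    (Lh : 'M[R]_M) (G g : R -> R) (kappa tau : R) : Prop :=
  forall (uh : nat -> 'cV[R]_M) (U : nat -> nat -> 'cV[R]_M),
  scheme_solution A Lh g kappa tau uh U ->
  dissipates_all_stages A Lh G kappa tau U.

End Scheme.

Definition mx_of_rows (R : realType) (s : nat) (rows : seq (seq R)) :
    'M[R]_s :=
  \matrix_(i, j) nth 0 (nth [::] rows i) j.

Definition TIF3_Ralston (R : realType) (z : R) : 'M[R]_3 :=
  let q := expR (3 * z / 4) * (9 - 2 * z) - 3 * expR (z / 4) * z - 4 * z in
  mx_of_rows 3
    [:: [:: 1 / (2 - z); 0; 0];
        [:: 0; 3 / (4 * expR (z / 2) - 3 * z); 0];
        [:: 2 * expR (3 * z / 4) / q; 3 * expR (z / 4) / q; 4 / q]].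

Definition NIF3_Ralston (R : realType) (z : R) : 'M[R]_3 :=
  mx_of_rows 3
    [:: [:: (expR (z / 2) - 1) / z; 0; 0];
        [:: 0; (expR (3 * z / 4) - 1) / z; 0];
        [:: 2 * expR z / 9; expR (z / 2) / 3;
            (expR z - 1) / z - expR (z / 2) / 3 - 2 * expR z / 9]].

(* Main.v *)
(* Since G' = -g with g Lipschitz and kappa >= 2 lg, the stage increment delta_k
   lowers the energy by at least (1/tau) <delta_k, (D delta)_k>, where the stage
   equations read (D delta)_k = tau g_kappa(U^k) - (tau/2) Lk (U^{k+1} + U^k);
   summing over k gives the first inequality.  In an orthonormal eigenbasis of Lk
   the second one becomes positivity of the scalar quadratic form of D(z) at
   z = - tau lambda < 0, and for both schemes the symmetric part of D(z) is
   diagonally dominant.  With p = e^{z/4}, this is algebra for TIF3; for NIF3 it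
   reduces to polynomial inequalities on 0 < p < 1 by the single transcendental
   bound - z p <= 2 (1 - p^2), that is, u <= sinh u at u = - z/4. *)
Require Import Defs.
From HB Require Import structures.
From mathcomp Require Import all_boot all_order all_algebra.
From mathcomp Require Import all_classical all_reals all_analysis.
From mathcomp Require Import complex ring lra.

Import Order.TTheory GRing.Theory Num.Theory.
Import numFieldNormedType.Exports.
Local Open Scope ring_scope.

Set Implicit Arguments.
Unset Strict Implicit.
Unset Printing Implicit Defensive.

(** * The spectral theorem for real symmetric matrices *)

(** The complexification [AC] is Hermitian and has an eigenvalue [a] by algebraic closedness;
    evaluating its form at an eigenvector in two ways gives [a * N = a^* * N], so [a] is real. *)
Lemma symmetric_eigenvalue (R : rcfType) (n : nat) (A : 'M[R]_n.+1) :
  A \is symmetricmx -> exists a, eigenvalue A a.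
Proof.
move=> /is_hermitianmxP/esym; rewrite scale1r map_mx_id// => Asym.
pose AC : 'M[R[i]]_n.+1 := map_mx (real_complex R) A.
have [a] := eigenvalue_closed AC (ltn0Sn n).
move=> aA; suff /complex_realP[k ak] : a \is Num.real.
  exists k; rewrite -(eigenvalue_map (real_complex R)).
  by rewrite -[eigenvalue _ _]/(eigenvalue AC (k%:C)%C) -ak.
have ACadj : map_mx Num.conj AC^T = AC.
  rewrite {1}/AC map_trmx Asym -map_mx_comp.
  by apply/matrixP => i j; rewrite !mxE /= conj_Creal//; apply/complex_realP;
    exists (A i j).
have [v vA v0] := eigenvalueP aA.
pose N := dotmx v v.
have N0 : N != 0 by rewrite gt_eqF// /N dotmx_is_dotmx.
have eN : a * N = a^* * N.
  have eE : v *m (map_mx Num.conj (v *m AC)^T) =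
            (v *m AC) *m map_mx Num.conj v^T.
    by rewrite trmx_mul map_mxM ACadj mulmxA.
  move: eE; rewrite vA linearZ/= map_mxZ -scalemxAl -scalemxAr.
  move=> /matrixP/(_ 0 0).
  by rewrite !mxE /N dotmxE mxE => ->.
by apply/CrealP/esym; apply: (mulIf N0).
Qed.

(* [H] is the Householder reflection exchanging [v / |v|] and the first basis
   vector. *)
Lemma orthogonal_row0 (R : rcfType) (n : nat) (v : 'rV[R]_n.+1) : v != 0 ->
  exists (H : 'M[R]_n.+1) (c : R),
    [/\ c != 0, H^T *m H = 1%:M & row 0 H = c *: v].
Proof.
have sqE (w : 'rV[R]_n.+1) : w *m w^T = (\sum_i w 0 i ^+ 2)%:M.
  by rewrite [LHS]mx11_scalar mxE; congr _%:M; apply: eq_bigr => i _;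
    rewrite mxE expr2.
have sq_gt0 (w : 'rV[R]_n.+1) : w != 0 -> 0 < \sum_i w 0 i ^+ 2.
  move=> w0; rewrite lt_def sumr_ge0 ?andbT; last by move=> i _; exact: sqr_ge0.
  apply: contra w0; rewrite psumr_eq0 => [/allP w0|i _]; last exact: sqr_ge0.
  apply/eqP/rowP => i; rewrite mxE; apply/eqP.
  by rewrite -sqrf_eq0; apply: (implyP (w0 i _)) => //; rewrite mem_index_enum.
move=> v0; pose c := (Num.sqrt (\sum_i v 0 i ^+ 2))^-1.
have c0 : c != 0 by rewrite invr_eq0 gt_eqF// sqrtr_gt0 sq_gt0.
pose e : 'rV[R]_n.+1 := delta_mx 0 0; pose u := c *: v.
have uu : u *m u^T = 1%:M.
  rewrite /u linearZ/= -scalemxAl -scalemxAr sqE scalerA -expr2 scale_scalar_mx.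
  by rewrite exprVn sqr_sqrtr ?mulVf// ?gt_eqF ?ltW ?sq_gt0.
have ee : e *m e^T = 1%:M.
  rewrite /e trmx_delta mul_delta_mx; apply/matrixP => i j.
  by rewrite !ord1 !mxE !eqxx.
(* For [u = e] the vector [w] vanishes and defines no reflection; the identity serves instead. *)
have [ue|ue] := eqVneq u e.
  exists 1%:M, c; split=> //; first by rewrite trmx1 mulmx1.
  by rewrite -/u ue rowE mulmx1.
pose w := u - e.
have w0 : w != 0 by rewrite subr_eq0.
pose N := \sum_i w 0 i ^+ 2.
have N0 : N != 0 by rewrite gt_eqF ?sq_gt0.
pose H := 1%:M - (2 / N) *: (w^T *m w).
have HT : H^T = H by rewrite /H linearB/= linearZ/= trmx_mul trmxK trmx1.
have H2 : H *m H = 1%:M.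
  have ww : w^T *m w *m (w^T *m w) = N *: (w^T *m w).
    by rewrite mulmxA -(mulmxA w^T) sqE -/N mul_mx_scalar -scalemxAl.
  rewrite /H; move: (w^T *m w) ww => W WW.
  rewrite mulmxBl mul1mx mulmxBr mulmx1 -scalemxAl -!scalemxAr WW.
  rewrite !scalerA -mulrA divfK// mulrC opprB -addrA -[RHS]addr0; congr (_ + _).
  by apply/matrixP => i j; rewrite !mxE; field.
exists H, c; split=> //; first by rewrite HT.
have eu : u *m e^T = e *m u^T.
  apply/matrixP => i j; rewrite !ord1 !mxE; apply: eq_bigr => k _.
  by rewrite !mxE mulrC.
(* Expansion of [|u - e|^2] for unit vectors; hence [e *m w^T] is [- (N / 2)] and
   [e *m H = e + w = u]. *)
have NE : N = 2 - 2 * (e *m u^T) 0 0.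
  have := sqE w; rewrite -/N {1 2}/w linearB/= mulmxBl !mulmxBr uu ee eu.
  move: (e *m u^T) => X /matrixP/(_ 0 0).
  by rewrite !mxE eqxx !mulr1n => <-; ring.
rewrite rowE -/e -/u /H mulmxBr mulmx1 -scalemxAr mulmxA.
rewrite [e *m w^T]mx11_scalar mul_scalar_mx scalerA.
have -> : (e *m w^T) 0 0 = - (N / 2).
  rewrite /w linearB/= mulmxBr ee NE; move: (e *m u^T) => X.
  by rewrite !mxE eqxx mulr1n; field.
by rewrite mulrN mulrA divfK ?divff ?pnatr_eq0// scaleN1r opprK addrC subrK.
Qed.

(** Deflation: an orthogonal change of basis makes an eigenvector the first basis vector, symmetry
    then clears the first row and column off the diagonal, and induction handles the remaining
    block. *)
Theorem real_spectral (R : rcfType) (n : nat) (A : 'M[R]_n) :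
  A \is symmetricmx ->
  exists (P : 'M[R]_n) (d : 'rV[R]_n),
    P^T *m P = 1%:M /\ A = P^T *m diag_mx d *m P.
Proof.
elim: n A => [A _|n IH A symA].
  by exists 1%:M, 0; split; rewrite [LHS]flatmx0 [RHS]flatmx0.
have [a /eigenvalueP[v vA v0]] := symmetric_eigenvalue symA.
have AT : A^T = A.
  by move: symA => /is_hermitianmxP/esym; rewrite scale1r map_mx_id.
have [H [c [c0 HH H0]]] := orthogonal_row0 v0.
have HH' : H *m H^T = 1%:M by apply: mulmx1C.
pose B := H *m A *m H^T.
have BT : B^T = B by rewrite /B !trmx_mul trmxK AT mulmxA.
have AB : A = H^T *m B *m H.
  by rewrite /B !mulmxA HH mul1mx -!mulmxA HH mulmx1.
have B0 : row 0 B = a *: delta_mx 0 0.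
  rewrite /B !row_mul H0 -scalemxAl vA scalerA mulrC -scalerA -scalemxAl.
  by rewrite -H0 -row_mul HH' rowE mulmx1.
clearbody B; pose B' : 'M[R]_(1 + n) := B.
have eB : B' = block_mx a%:M 0 0 (drsubmx B').
  rewrite -[LHS]submxK; congr block_mx.
  - apply/matrixP => i j; rewrite !ord1 !mxE.
    move/rowP/(_ 0): B0; rewrite !mxE/= mulr1 => <-.
    by congr (B _ _); apply/val_inj.
  - apply/matrixP => i j; rewrite !ord1 !mxE.
    move/rowP/(_ (rshift 1 j)): B0; rewrite !mxE/= mulr0 => <-.
    by congr (B _ _); apply/val_inj.
  - apply/matrixP => i j; rewrite !ord1 !mxE.
    move/rowP/(_ (rshift 1 i)): B0; rewrite !mxE/= mulr0 => <-.
    by rewrite -BT mxE; congr (B _ _); apply/val_inj.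
have /IH[Q [d [QQ eD]]] : drsubmx B' \is symmetricmx.
  apply/is_hermitianmxP; rewrite scale1r map_mx_id// trmx_drsub.
  by congr drsubmx; rewrite /B' BT.
pose K : 'M[R]_(1 + n) := block_mx 1%:M 0 0 Q.
exists (K *m H), (row_mx a%:M d : 'rV[R]_(1 + n)); split.
  rewrite trmx_mul -mulmxA (mulmxA K^T) /K tr_block_mx mulmx_block.
  rewrite !trmx0 trmx1 !(mul0mx, mulmx0, mul1mx, addr0, add0r) QQ.
  by rewrite -scalar_mx_block mul1mx.
have eK : block_mx a%:M 0 0 (Q^T *m diag_mx d *m Q) =
    K^T *m diag_mx (row_mx a%:M d) *m K.
  rewrite diag_mx_row /K tr_block_mx !mulmx_block.
  rewrite !trmx0 trmx1 !(mul0mx, mulmx0, mul1mx, addr0, add0r, mulmx1).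
  by congr block_mx; apply/matrixP => i j; rewrite !ord1 !mxE.
rewrite [in LHS]AB trmx_mul -[B]/B' eB eD -!mulmxA; congr (_ *m _).
by rewrite !mulmxA; congr (_ *m _); exact: eK.
Qed.

(** * Inner products, matrix functions and triangular inverses *)

Lemma innerE (R : realType) (m : nat) (u v : 'cV[R]_m) :
  inner u v = \sum_i u i 0 * v i 0.
Proof. by rewrite /inner mxE; apply: eq_bigr => i _; rewrite mxE mulrC. Qed.

Lemma innerC (R : realType) (m : nat) (u v : 'cV[R]_m) : inner u v = inner v u.
Proof. by rewrite !innerE; apply: eq_bigr => i _; rewrite mulrC. Qed.

Lemma inner_diag (R : realType) (m : nat) (P : 'M[R]_m) (d : 'rV[R]_m)
    (u v : 'cV[R]_m) :
  inner u (P^T *m diag_mx d *m P *m v) =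
  \sum_i (P *m u) i 0 * d 0 i * (P *m v) i 0.
Proof.
rewrite innerC /inner -!mulmxA mulmxA -trmx_mul mxE; apply: eq_bigr => i _.
by rewrite mul_diag_mx !mxE mulrA.
Qed.

Lemma funmx_orthogonal (R : realType) (m : nat) (f : R -> R) (P : 'M[R]_m)
    (d : 'rV[R]_m) : P^T *m P = 1%:M ->
  funmx f (P^T *m diag_mx d *m P) = P^T *m diag_mx (map_mx f d) *m P.
Proof.
move=> PP; have Pu : P \in unitmx by case: (mulmx1_unit PP).
have iP : invmx P = P^T by rewrite -[LHS]mul1mx -PP -mulmxA mulmxV// mulmx1.
by rewrite -iP funmx_diag.
Qed.

Lemma inner_funmx (R : realType) (m : nat) (f : R -> R) (P : 'M[R]_m)
    (d : 'rV[R]_m) (u v : 'cV[R]_m) : P^T *m P = 1%:M ->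
  inner u (funmx f (P^T *m diag_mx d *m P) *m v) =
  \sum_i (P *m u) i 0 * f (d 0 i) * (P *m v) i 0.
Proof.
move=> PP; rewrite funmx_orthogonal// inner_diag.
by apply: eq_bigr => i _; congr (_ * _ * _); rewrite mxE.
Qed.

Lemma inner_orthogonal (R : realType) (m : nat) (P : 'M[R]_m) (u v : 'cV[R]_m) :
  P^T *m P = 1%:M -> inner (P *m u) (P *m v) = inner u v.
Proof.
by move=> PP; rewrite /inner trmx_mul mulmxA -(mulmxA _ P^T) PP mulmx1.
Qed.

Lemma mode_diag (R : realType) (m : nat) (P : 'M[R]_m) (d : 'rV[R]_m)
    (v : 'cV[R]_m) (i : 'I_m) : P^T *m P = 1%:M ->
  (P *m (P^T *m diag_mx d *m P *m v)) i 0 = d 0 i * (P *m v) i 0.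
Proof.
by move=> /mulmx1C PP; rewrite !mulmxA PP mul1mx -mulmxA mul_diag_mx mxE.
Qed.

Lemma mode_funmx (R : realType) (m : nat) (f : R -> R) (P : 'M[R]_m)
    (d : 'rV[R]_m) (v : 'cV[R]_m) (i : 'I_m) : P^T *m P = 1%:M ->
  (P *m (funmx f (P^T *m diag_mx d *m P) *m v)) i 0 =
  f (d 0 i) * (P *m v) i 0.
Proof.
by move=> PP; rewrite funmx_orthogonal// mode_diag//; congr (_ * _); rewrite mxE.
Qed.

(** For [i < j], entry [(i, j)] of [A *m invmx A = 1] reduces to the term [k = i]: larger [k] vanish
    by triangularity of [A], smaller ones by induction on the row. *)
Lemma trig_invmx (F : fieldType) (n : nat) (A : 'M[F]_n) :
  is_trig_mx A -> A \in unitmx -> is_trig_mx (invmx A).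
Proof.
move=> trA uA; apply/is_trig_mxP => i j.
have Aii (k : 'I_n) : A k k != 0.
  move: uA; rewrite unitmxE unitfE det_trig// => /prodf_neq0; exact.
have [m] := ubnP i; elim: m i => // m IH i; rewrite ltnS => im ij.
have /matrixP/(_ i j) := mulmxV uA; rewrite !mxE -val_eqE/= ltn_eqF// mulr0n.
rewrite (bigD1 i)//= big1 ?addr0 => [/eqP|k ki].
  by rewrite mulf_eq0 (negPf (Aii i)) => /eqP.
have [ik|ki'] := ltnP i k; first by rewrite (is_trig_mxP trA)// mul0r.
have {}ki' : (k < i)%N.
  by rewrite ltn_neqAle ki' -(inj_eq val_inj) in ki *; rewrite ki.
by rewrite IH ?mulr0 ?(leq_trans ki' im) ?(ltn_trans ki' ij).
Qed.

(* [Defs.diffmx] is qualified because [mxalgebra] has a [diffmx] too. *)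
Lemma trig_diffmx (R : realType) (s : nat) (A : R -> 'M[R]_s) (z : R) :
  is_trig_mx (A z) -> A z \in unitmx -> is_trig_mx (Defs.diffmx A z).
Proof.
move=> trA uA; apply/is_trig_mxP => i j ij; rewrite !mxE big1.
  by rewrite leqNgt ij/= mulr0 -val_eqE/= ltn_eqF// mulr0n subr0 addr0.
move=> k _; rewrite !mxE; case: leqP => jk; last by rewrite mulr0.
by rewrite (is_trig_mxP (trig_invmx trA uA)) ?mul0r// (leq_trans ij).
Qed.

(** * Energy change across one increment *)

(** The mean value theorem gives the slope [- g c] with [c] between [u] and [v]; replacing [g c] by
    [g u] costs at most [lg * |v - u|]. *)
Lemma Lipschitz_derivative_le (R : realType) (G g : R -> R) (lg : R) :
  (forall v, derivable G v 1) -> (forall v, g v = - (G^`()%classic v)) ->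
  (lg.-lipschitz g)%type ->
  forall u v, G v - G u <= - g u * (v - u) + lg * (v - u) ^+ 2.
Proof.
move=> dG gE lip u v.
have [c [eG uc]] : exists c,
    G v - G u = - g c * (v - u) /\ `|u - c| <= `|v - u|.
  have isd (x : R) : is_derive x (1 : R) G (- g x).
    by rewrite gE opprK derive1E; apply: DeriveDef.
  have cG (a b : R) : {within `[a, b], continuous G}%classic.
    apply: continuous_subspaceT => x.
    by apply: differentiable_continuous; apply/derivable1_diffP.
  have [uv|vu] := leP u v.
    have [c cab ->] := MVT_segment uv (fun x _ => isd x) (cG u v).
    exists c; split=> //; move: cab; rewrite in_itv/= => /andP[uc cv].
    by rewrite distrC !ger0_norm ?subr_ge0// lerD2r.
  have [c cab eG] := MVT_segment (ltW vu) (fun x _ => isd x) (cG v u).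
  exists c; split; first by rewrite -opprB eG; ring.
  move: cab; rewrite in_itv/= => /andP[vc cu].
  by rewrite [leRHS]distrC !ger0_norm ?subr_ge0 ?(ltW vu)// lerB.
have lip_uc : `|g u - g c| <= lg * `|u - c| by exact: (lip (u, c)).
rewrite eG -lerBlDl.
have -> : - g c * (v - u) - - g u * (v - u) = (g u - g c) * (v - u) by ring.
apply: le_trans (ler_norm _) _; rewrite normrM -(real_normK (num_real _)).
rewrite expr2 mulrA ler_wpM2r//; apply: le_trans lip_uc _.
(* A negative [lg] would contradict the Lipschitz bound at the points 1 and 0. *)
have [lg0|lg0] := leP 0 lg; first by rewrite ler_wpM2l.
have := le_trans (normr_ge0 _) (lip (1, 0) (conj I I)).
by rewrite /= subr0 normr1 mulr1 leNgt lg0.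
Qed.

Lemma inner_Lstab (R : realType) (m : nat) (Lh : 'M[R]_m) (kappa : R)
    (v : 'cV[R]_m) :
  inner v (Lstab Lh kappa *m v) = inner v (Lh *m v) + kappa * inner v v.
Proof.
rewrite /Lstab mulmxDl mul_scalar_mx !innerE mulr_sumr -big_split/=.
by apply: eq_bigr => i _; rewrite !mxE; ring.
Qed.

(** The [Lh] terms cancel. Componentwise the gap is [kappa / 2 * (b - a) ^+ 2 - g a * (b - a) - (G b
    - G a)], which is at least [(kappa / 2 - lg) * (b - a) ^+ 2]. *)
Lemma energy_step (R : realType) (m : nat) (Lh : 'M[R]_m) (G g : R -> R)
    (lg kappa : R) (u v : 'cV[R]_m) :
  (forall a b, G b - G a <= - g a * (b - a) + lg * (b - a) ^+ 2) ->
  2 * lg <= kappa ->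
  energy Lh G v - energy Lh G u <=
  2^-1 * (inner v (Lstab Lh kappa *m v) - inner u (Lstab Lh kappa *m u))
  - inner (v - u) (gstab g kappa u).
Proof.
move=> Gle lgk; rewrite /energy !inner_Lstab.
rewrite -subr_ge0; set e := (X in 0 <= X).
have -> : e = \sum_i (kappa / 2 * (v i 0 ^+ 2 - u i 0 ^+ 2)
    - (v i 0 - u i 0) * (kappa * u i 0 + g (u i 0)) - (G (v i 0) - G (u i 0))).
  rewrite /e; set a := inner v (Lh *m v); set b := inner u (Lh *m u).
  rewrite !innerE !sumrB -mulr_sumr sumrB.
  under [\sum_i v i 0 ^+ 2]eq_bigr do rewrite expr2.
  under [\sum_i u i 0 ^+ 2]eq_bigr do rewrite expr2.
  under [\sum_i (v - u) i 0 * _]eq_bigr do rewrite !mxE.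
  under [\sum_i (map_mx G v) i 0 * _]eq_bigr do rewrite !mxE mulr1.
  under [\sum_i (map_mx G u) i 0 * _]eq_bigr do rewrite !mxE mulr1.
  by field.
apply: sumr_ge0 => i _; have := Gle (u i 0) (v i 0).
move: (u i 0) (v i 0) => a b Gab.
have : 0 <= (kappa - 2 * lg) * (b - a) ^+ 2.
  by rewrite mulr_ge0 ?subr_ge0// sqr_ge0.
move: Gab; rewrite !expr2; lra.
Qed.

(** * Stage equations in terms of D(z) and its leading blocks *)

Lemma telescope_Emx (R : realType) (s : nat) (w : nat -> R) :
  Emx R s *m \col_k (w k.+1 - w k) = \col_k (w k.+1 - w 0%N).
Proof.
apply/matrixP => i j; rewrite !mxE.
rewrite -(telescope_sumr w (leq0n i.+1)) big_mkord
  (big_ord_widen _ (fun k => w k.+1 - w k) (ltn_ord i)).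
rewrite [RHS]big_mkcond/=; apply: eq_bigr => k _; rewrite !mxE ltnS.
by case: ifP; rewrite ?mul1r ?mul0r.
Qed.

(** One scalar mode of the scheme, [r] being its nonlinear part. The stages make the
    [invmx (A z) *m Emx] term equal to [r k + z * w 0]; the other two add [z * (w k.+1 - w 0) - z /
    2 * (w k.+1 - w k)]. *)
Lemma diffmx_increments (R : realType) (s : nat) (A : R -> 'M[R]_s) (z : R)
    (w r : nat -> R) : A z \in unitmx ->
  (forall i : 'I_s, w i.+1 = w 0%N + \sum_j A z i j * (r j + z * w 0%N)) ->
  Defs.diffmx A z *m \col_k (w k.+1 - w k) =
  \col_k (r k + z / 2 * (w k.+1 + w k)).
Proof.
move=> uA wE.
have Ew : Emx R s *m \col_k (w k.+1 - w k) = A z *m \col_k (r k + z * w 0%N).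
  rewrite telescope_Emx; apply/matrixP => i j; rewrite !mxE wE addrC addKr.
  by apply: eq_bigr => k _; rewrite mxE.
rewrite /Defs.diffmx mulmxBl mulmxDl -mulmxA -scalemxAl Ew mulKmx// -Ew.
rewrite telescope_Emx mul_scalar_mx; apply/matrixP => i j; rewrite !mxE.
by field.
Qed.

(** Row [i < j] of a lower triangular matrix meets only columns before [j], so the system for the
    first [j] increments is the top of the full one. *)
Lemma leading_trig_mul (R : realType) (s j : nat) (hj : (j <= s)%N)
    (B : 'M[R]_s) (v : 'cV[R]_s) : is_trig_mx B ->
  leading hj B *m rowsub (widen_ord hj) v = rowsub (widen_ord hj) (B *m v).
Proof.
move=> /is_trig_mxP trB; apply/matrixP => i k; rewrite !mxE.
rewrite [RHS](bigID (fun l : 'I_s => (l < j)%N))/= [X in _ + X]big1 ?addr0.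
  rewrite (big_ord_narrow hj); apply: eq_bigr => l _; rewrite !mxE.
  by congr (_ * v _ _); rewrite ?ord1.
move=> l; rewrite -leqNgt => jl; rewrite trB ?mul0r//.
exact: leq_trans (ltn_ord i) jl.
Qed.

Lemma leading_psd (R : realType) (s j : nat) (hj : (j <= s)%N) (B : 'M[R]_s) :
  (forall v, 0 <= inner v (B *m v)) ->
  forall v, 0 <= inner v (leading hj B *m v).
Proof.
move=> Bpsd v; pose S := rowsub (widen_ord hj) (1%:M : 'M[R]_s).
have -> : leading hj B = S *m B *m S^T.
  by rewrite /S trmx_mxsub trmx1 -rowsubE -mxsub_mul mulmx1.
suff -> : inner v (S *m B *m S^T *m v) =
          inner (S^T *m v) (B *m (S^T *m v)) by [].
by rewrite /inner !trmx_mul !trmxK !mulmxA.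
Qed.

(** * Reduction to scalar quadratic forms, mode by mode *)

Lemma spd_Lstab (R : realType) (m : nat) (Lh : 'M[R]_m) (kappa : R) :
  spd Lh -> 0 <= kappa -> spd (Lstab Lh kappa).
Proof.
move=> [symL posL] k0; split.
  move: symL => /is_hermitianmxP/esym; rewrite scale1r map_mx_id// => symL.
  apply/is_hermitianmxP; rewrite scale1r map_mx_id//.
  by rewrite /Lstab linearD/= symL tr_scalar_mx.
move=> v v0; rewrite inner_Lstab ltr_pwDl ?posL// mulr_ge0// innerE.
by apply: sumr_ge0 => i _; rewrite -expr2 sqr_ge0.
Qed.

Lemma spd_spectral (R : realType) (m : nat) (L : 'M[R]_m) : spd L ->
  exists (P : 'M[R]_m) (d : 'rV[R]_m),
    [/\ P^T *m P = 1%:M, L = P^T *m diag_mx d *m P & forall i, 0 < d 0 i].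
Proof.
move=> [symL posL]; have [P [d [PP LE]]] := real_spectral symL.
exists P, d; split=> // i.
have PP' : P *m P^T = 1%:M by exact: mulmx1C.
have := posL (P^T *m delta_mx i 0); rewrite LE inner_diag !mulmxA PP' mul1mx.
rewrite (bigD1 i)//= !mxE !eqxx mul1r mulr1 big1 ?addr0 => [|k ki]; last first.
  by rewrite !mxE (negPf ki) !mul0r.
apply; apply/eqP => /(congr1 (mulmx P)); rewrite mulmxA PP' mul1mx mulmx0.
by move=> /matrixP/(_ i 0)/eqP; rewrite !mxE !eqxx oner_eq0.
Qed.

(** All blocks are functions of one matrix, hence diagonal in the same eigenbasis; exchanging the
    sums over blocks and modes leaves one scalar form per mode. *)
Lemma blockfunmx_inner (R : realType) (m j : nat) (D : R -> 'M[R]_j)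
    (P : 'M[R]_m) (d : 'rV[R]_m) (V : nat -> 'cV[R]_m) : P^T *m P = 1%:M ->
  inner (increments j V)
    (blockfunmx D (P^T *m diag_mx d *m P) *m increments j V) =
  \sum_i let w := \col_(k < j) ((P *m V k.+2) i 0 - (P *m V k.+1) i 0) in
         inner w (D (d 0 i) *m w).
Proof.
move=> PP; rewrite /blockfunmx /increments mul_mxblock_mxrow.
rewrite [LHS]innerC [LHS]/inner tr_mxcol mul_mxrow_mxcol summxE.
under eq_bigr => k _.
  rewrite mulmx_sumr summxE; under eq_bigr => l _.
    rewrite -/(inner _ _) innerC inner_funmx//.
    over.
  over.
rewrite [LHS]/=.
under [LHS]eq_bigr do rewrite exchange_big/=.
rewrite exchange_big/=; apply: eq_bigr => i _.
rewrite [RHS]/= innerE; apply: eq_bigr => k _.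
have PB l : (P *m (V l.+1 - V l)) i 0 = (P *m V l.+1) i 0 - (P *m V l) i 0.
  by rewrite mulmxBr mxE [X in _ + X]mxE.
rewrite mxE [X in _ * X]mxE mulr_sumr; apply: eq_bigr => l _.
by rewrite [X in _ * (_ * X)]mxE !PB mulrA.
Qed.

Lemma preserves_dissipation_of_psd (R : realType) (m s : nat)
    (A : R -> 'M[R]_s) (Lh : 'M[R]_m) (G g : R -> R) (lg kappa tau : R) :
  (forall z, z < 0 -> is_trig_mx (A z)) ->
  (forall z, z < 0 -> A z \in unitmx) ->
  (forall z, z < 0 -> forall v, 0 <= inner v (Defs.diffmx A z *m v)) ->
  spd Lh ->
  (forall a b, G b - G a <= - g a * (b - a) + lg * (b - a) ^+ 2) ->
  0 <= kappa -> 2 * lg <= kappa -> 0 < tau ->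
  preserves_dissipation A Lh G g kappa tau.
Proof.
move=> trA uA Dpsd spdL Gle k0 lgk tau0 uh U sol n j hj n1 j1 /=.
set dU := increments _ _; set Dj := blockfunmx _ _.
have [P [d [PP LE d0]]] := spd_spectral (spd_Lstab spdL k0).
pose z : 'rV[R]_m := - tau *: d.
have zE i : z 0 i = - tau * d 0 i by rewrite mxE.
have z0 i : z 0 i < 0 by rewrite zE mulNr oppr_lt0 mulr_gt0.
have tLE : - tau *: Lstab Lh kappa = P^T *m diag_mx z *m P.
  by rewrite LE /z linearZ/= -scalemxAr -scalemxAl.
clearbody z.
have [_ stage _] := sol n n1.
(* The shift makes [V 0] the initial stage, as [diffmx_increments] expects. *)
pose V k := U n k.+1.
have sE i : Defs.diffmx A (z 0 i) *m
    \col_(k < s) ((P *m V k.+1) i 0 - (P *m V k) i 0) =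
    \col_(k < s) (tau * (P *m gstab g kappa (V k)) i 0 +
       z 0 i / 2 * ((P *m V k.+1) i 0 + (P *m V k) i 0)).
  apply: (@diffmx_increments _ _ _ _ (fun k => (P *m V k) i 0)
    (fun k => tau * (P *m gstab g kappa (V k)) i 0)); first exact: uA.
  move=> k; rewrite /V stage mulmxDr mxE mulmx_sumr summxE; congr (_ + _).
  rewrite big_mkcond/=; apply: eq_bigr => l _.
  (* Indices outside the range [l <= k] of the scheme carry zero entries of the triangular [A]. *)
  case: leqP => [lk|kl]; last first.
    by rewrite (is_trig_mxP (trA _ (z0 i))) ?mul0r.
  rewrite tLE mode_funmx//; congr (_ * _).
  rewrite mulmxBr -!scalemxAr mxE [X in X + _]mxE [X in _ + X]mxE.
  rewrite [X in - X]mxE LE mode_diag// zE.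
  by ring.
(* Pairing with the increment turns [z / 2 * (w k.+1 + w k)] into a difference of squares, which
   sums over the modes to a difference of [Lstab] forms. *)
have innerD : inner dU (Dj *m dU) =
    \sum_(k < j) (tau * inner (V k.+1 - V k) (gstab g kappa (V k))
      - tau / 2 * (inner (V k.+1) (Lstab Lh kappa *m V k.+1)
                   - inner (V k) (Lstab Lh kappa *m V k))).
  rewrite /Dj tLE blockfunmx_inner//.
  under eq_bigr => i _.
    rewrite (_ : \col_(k < j) _ = rowsub (widen_ord hj)
      (\col_(k < s) ((P *m V k.+1) i 0 - (P *m V k) i 0))); last first.
      by apply/matrixP => a b; rewrite !mxE.
    rewrite /= leading_trig_mul; last first.
      exact: trig_diffmx (trA _ (z0 i)) (uA _ (z0 i)).
    rewrite sE innerE.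
    over.
  rewrite exchange_big/=; apply: eq_bigr => k _.
  rewrite -(inner_orthogonal _ _ PP) LE !inner_diag innerE.
  rewrite -sumrB !mulr_sumr -sumrB.
  apply: eq_bigr => i _; rewrite 2![X in X * _]mxE 2![X in _ * X]mxE zE.
  rewrite mulmxBr [X in _ * (X * _)]mxE [X in _ * ((_ + X) * _)]mxE /=.
  by field.
apply/andP; split.
  rewrite innerD mulr_sumr -sumrN.
  have -> : energy Lh G (U n j.+1) - energy Lh G (U n 1%N) =
    \sum_(k < j) (energy Lh G (V k.+1) - energy Lh G (V k)).
    by rewrite -(big_mkord xpredT
        (fun k => energy Lh G (V k.+1) - energy Lh G (V k)))
      telescope_sumr.
  apply: ler_sum => k _.
  apply: le_trans (energy_step Lh (V k) (V k.+1) Gle lgk) _.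
  rewrite le_eqVlt; apply/orP; left; apply/eqP; field; exact: lt0r_neq0.
rewrite oppr_le0 mulr_ge0 ?invr_ge0 ?(ltW tau0)//.
rewrite /Dj tLE blockfunmx_inner//; apply: sumr_ge0 => i _.
by apply: leading_psd; apply: Dpsd.
Qed.

(** * The hyperbolic sine bound and diagonal dominance *)

(** The difference vanishes at 0 and its derivative is [(expR c - 1) ^+ 2 / expR c]. *)
Lemma ler_sinh (R : realType) (u : R) : 0 <= u -> 2 * u <= expR u - expR (- u).
Proof.
move=> u0; pose f (x : R) := expR x - expR (- x) - 2 * x.
have df (x : R) : is_derive x (1 : R) f (expR x + expR (- x) - 2).
  by apply: is_derive_eq; rewrite /= ?scaler1 ?mulr1; ring.
have cf : {within `[0, u], continuous f}%classic.
  apply: continuous_subspaceT => x.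
  by apply: differentiable_continuous; apply/derivable1_diffP.
have [c _] := MVT_segment u0 (fun x _ => df x) cf.
rewrite /f oppr0 expR0 mulr0 oppr0 subrr !addr0 oppr0 addr0 => fu.
rewrite -subr_ge0 fu mulr_ge0// expRN.
have c0 := expR_gt0 c; rewrite -(pmulr_rge0 _ c0).
have -> : expR c * (expR c + (expR c)^-1 - 2) = (expR c - 1) ^+ 2.
  by field; rewrite lt0r_neq0.
exact: sqr_ge0.
Qed.

(** Each cross term [k * s * t] is at least [- |k| * (s ^+ 2 + t ^+ 2) / 2], and the hypotheses let
    the squares absorb these halves. *)
Lemma diag_dominant3 (R : realFieldType) (a b c p q r x y w : R) :
  `|a| + `|b| <= 2 * p -> `|a| + `|c| <= 2 * q -> `|b| + `|c| <= 2 * r ->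
  0 <= p * x ^+ 2 + q * y ^+ 2 + r * w ^+ 2 + a * x * y + b * x * w + c * y * w.
Proof.
have cross (k s t : R) : - (`|k| * (s ^+ 2 + t ^+ 2) / 2) <= k * s * t.
  have h1 : 0 <= (`|k| + k) * (s + t) ^+ 2.
    by rewrite mulr_ge0 ?sqr_ge0// -[X in _ + X]opprK subr_ge0 -normrN ler_norm.
  have h2 : 0 <= (`|k| - k) * (s - t) ^+ 2.
    by rewrite mulr_ge0 ?sqr_ge0// subr_ge0 ler_norm.
  rewrite -subr_ge0; have := addr_ge0 h1 h2.
  move: `|k| => m; lra.
move=> /(ler_wpM2r (sqr_ge0 x)) h1 /(ler_wpM2r (sqr_ge0 y)) h2.
move=> /(ler_wpM2r (sqr_ge0 w)) h3.
have := cross a x y; have := cross b x w; have := cross c y w.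
move: h1 h2 h3; move: `|a| `|b| `|c| => ? ? ?; lra.
Qed.

(** * The sparsity pattern common to both schemes and its D(z) *)

Definition ralston_mx (R : realType) (a b c d e : R) : 'M[R]_3 :=
  mx_of_rows 3 [:: [:: a; 0; 0]; [:: 0; b; 0]; [:: c; d; e]].

Lemma ralston_mx_trig (R : realType) (a b c d e : R) :
  is_trig_mx (ralston_mx a b c d e).
Proof.
by apply/is_trig_mxP => -[[|[|[|//]]] ?] [[|[|[|//]]] ?]; rewrite !mxE.
Qed.

Definition ralston_inv (R : realType) (a b c d e : R) : 'M[R]_3 :=
  ralston_mx a^-1 b^-1 (- c / (a * e)) (- d / (b * e)) e^-1.

Lemma ralston_mxV (R : realType) (a b c d e : R) :
  a != 0 -> b != 0 -> e != 0 ->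
  ralston_mx a b c d e *m ralston_inv a b c d e = 1%:M.
Proof.
move=> a0 b0 e0; apply/matrixP => -[[|[|[|//]]] ?] [[|[|[|//]]] ?];
  rewrite !mxE !big_ord_recl big_ord0 !mxE/=; field; rewrite ?a0 ?b0 ?e0//.
Qed.

Lemma ralston_mx_unit (R : realType) (a b c d e : R) :
  a != 0 -> b != 0 -> e != 0 -> ralston_mx a b c d e \in unitmx.
Proof. by move=> a0 b0 e0; case: (mulmx1_unit (ralston_mxV c d a0 b0 e0)). Qed.

(* [D21], [D31], [D32] are the off-diagonal entries of [diffmx A z]. *)
Lemma ralston_diffmx_psd (R : realType) (A : R -> 'M[R]_3) (z a b c d e : R) :
  A z = ralston_mx a b c d e -> a != 0 -> b != 0 -> e != 0 ->
  let D21 := b^-1 + z in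
  let D31 := (1 - c / a - d / b) / e + z in
  let D32 := (1 - d / b) / e + z in
  `|D21| + `|D31| <= 2 * (a^-1 + z / 2) ->
  `|D21| + `|D32| <= 2 * (b^-1 + z / 2) ->
  `|D31| + `|D32| <= 2 * (e^-1 + z / 2) ->
  forall v, 0 <= inner v (Defs.diffmx A z *m v).
Proof.
move=> AE a0 b0 e0 D21 D31 D32 h1 h2 h3 v.
have Vmx : invmx (A z) = ralston_inv a b c d e.
  rewrite AE -[LHS]mulmx1 -(ralston_mxV c d a0 b0 e0) mulKmx//.
  exact: ralston_mx_unit.
have := diag_dominant3 (v 0 0) (v 1 0) (v 2 0) h1 h2 h3.
congr (0 <= _); rewrite innerE /Defs.diffmx Vmx.
rewrite !big_ord_recl big_ord0 !mxE !big_ord_recl !big_ord0 !mxE.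
rewrite !big_ord_recl !big_ord0 !mxE/= /D21 /D31 /D32.
have -> : lift ord0 (lift ord0 ord0) = 2 :> 'I_3 by exact: val_inj.
have -> : lift ord0 ord0 = 1 :> 'I_3 by exact: val_inj.
field; rewrite ?a0 ?b0 ?e0//.
Qed.

Lemma expR_quarters (R : realType) (z : R) (p := expR (z / 4)) : z < 0 ->
  [/\ expR (z / 2) = p ^+ 2, expR (3 * z / 4) = p ^+ 3, expR z = p ^+ 4,
      0 < p < 1 & - z * p <= 2 * (1 - p ^+ 2)].
Proof.
move=> z0; have p0 : 0 < p by exact: expR_gt0.
rewrite /p -!expRM_natl; split.
- by congr expR; field.
- by congr expR; field.
- by congr expR; field.
- by rewrite expR_gt0 -[ltRHS]expR0 ltr_expR; lra.
(* At [u = - (z / 4)], multiplying [2 * u <= p^-1 - p] by [p] clears the denominator. *)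
have u0 : 0 <= - (z / 4) by lra.
have := ler_wpM2r (ltW p0) (ler_sinh u0); rewrite opprK expRN -/p mulrBl.
by rewrite mulVf ?gt_eqF// -expr2 expRM_natl -/p; lra.
Qed.

(** * The TIF3-Ralston scheme *)

(** The off-diagonal entries of D(z) simplify to [4 / 3 * p ^+ 2], [p ^+ 3 / 4] and
    [p ^+ 3 * (5 / 4 - z / 2)]. All are nonnegative, so the absolute values disappear and dominance
    follows from [p ^+ 3 <= p ^+ 2 <= 1] and [z < 0]. *)
Lemma TIF3_dissipation (R : realType) (z : R) : z < 0 ->
  [/\ is_trig_mx (TIF3_Ralston z), TIF3_Ralston z \in unitmx
    & forall v, 0 <= inner v (Defs.diffmx (@TIF3_Ralston R) z *m v)].
Proof.
move=> z0; have [e2 e3 e4 /andP[p0 p1] _] := expR_quarters z0.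
set p := expR (z / 4) in e2 e3 e4 p0 p1.
pose q := p ^+ 3 * (9 - 2 * z) - 3 * p * z - 4 * z.
have AE : TIF3_Ralston z = ralston_mx (1 / (2 - z)) (3 / (4 * p ^+ 2 - 3 * z))
    (2 * p ^+ 3 / q) (3 * p / q) (4 / q).
  by rewrite /TIF3_Ralston e2 e3.
have p2 : 0 < p ^+ 2 by rewrite exprn_gt0.
have p3 : 0 < p ^+ 3 by rewrite exprn_gt0.
have a0 : 2 - z != 0 by rewrite gt_eqF//; lra.
have b0 : 4 * p ^+ 2 - 3 * z != 0 by rewrite gt_eqF//; lra.
have pz : 0 < - z * p by rewrite mulr_gt0// oppr_gt0.
have p3z : 0 < - z * p ^+ 3 by rewrite mulr_gt0// oppr_gt0.
have q0 : q != 0 by rewrite gt_eqF// /q; lra.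
have p32 : p ^+ 3 <= p ^+ 2 by rewrite exprS ler_piMl ?ltW.
have p21 : p ^+ 2 <= 1 by rewrite exprn_ile1 ?ltW.
have p3z' : - z * p ^+ 3 <= - z.
  by rewrite ler_piMr//; [lra | exact: le_trans p32 p21].
have nz (x y : R) : x != 0 -> y != 0 -> x / y != 0.
  by move=> x0 y0; rewrite mulf_neq0 ?invr_eq0.
set a := 1 / (2 - z) in AE; set b := 3 / _ in AE; set c := 2 * _ / q in AE.
set d := _ * p / q in AE; set e := 4 / q in AE.
have an0 : a != 0 by rewrite nz.
have bn0 : b != 0 by rewrite nz.
have en0 : e != 0 by rewrite nz.
rewrite AE; split; [exact: ralston_mx_trig | exact: ralston_mx_unit|].
have aE : a^-1 = 2 - z by rewrite /a; field.
have bE : b^-1 = 4 / 3 * p ^+ 2 - z by rewrite /b; field.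
have eE : e^-1 = q / 4 by rewrite /e; field.
have D32E : (1 - d / b) / e + z = p ^+ 3 * (5 / 4 - z / 2).
  have -> : (1 - d / b) / e = q / 4 - 3 * p / 4 * b^-1.
    by rewrite /d /e; field; rewrite ?q0 ?an0 ?bn0.
  by rewrite bE /q; field.
have D31E : (1 - c / a - d / b) / e + z = p ^+ 3 / 4.
  have -> : (1 - c / a - d / b) / e =
      q / 4 - p ^+ 3 / 2 * a^-1 - 3 * p / 4 * b^-1.
    by rewrite /c /d /e; field; rewrite ?q0 ?an0 ?bn0.
  by rewrite aE bE /q; field.
apply: (ralston_diffmx_psd AE) => //; rewrite ?D31E ?D32E ?aE ?bE ?eE.
all: rewrite !ger0_norm /q; lra.
Qed.

(* Below, polynomials in [p] are shown nonnegative on [0, 1] by expanding them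
   with nonnegative coefficients over these products, leaving the linear
   arithmetic to [lra]. *)
Lemma bernstein_ge0 (R : realDomainType) (p : R) (i j : nat) :
  0 <= p <= 1 -> 0 <= p ^+ i * (1 - p) ^+ j.
Proof. by case/andP=> p0 p1; rewrite mulr_ge0 ?exprn_ge0 ?subr_ge0. Qed.

(** * Polynomial inequalities for NIF3-Ralston *)

Section NIF3Inequalities.
Variables (R : realFieldType) (p x : R).
Hypotheses (p01 : 0 < p < 1) (x0 : 0 < x) (xp : x * p <= 2 * (1 - p ^+ 2)).
(** For [x = - z], the diagonal entries of [NIF3_Ralston z] are [A / x], [B / x] and [N / x]. *)
Let A := 1 - p ^+ 2.
Let B := 1 - p ^+ 3.
Let N := 1 - p ^+ 4 - x * (p ^+ 2 / 3 + 2 * p ^+ 4 / 9).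

Let bern i j : 0 <= p ^+ i * (1 - p) ^+ j.
Proof. by apply: bernstein_ge0; case/andP: p01 => /ltW-> /ltW->. Qed.

(* Each claim is affine in [x * p], with slope [- k <= 0], so it suffices to
   check it at [x * p = 2 * (1 - p ^+ 2)]. *)
Let slope k : 0 <= k -> x * p * k <= 2 * (1 - p ^+ 2) * k.
Proof. by move=> k0; rewrite ler_wpM2r. Qed.

Lemma NIF3_N_gt0 : 0 < N.
Proof.
have /andP[p0 p1] := p01.
have k0 : 0 <= p / 3 + 2 * p ^+ 3 / 9.
  by have := bern 1 0; have := bern 3 0; lra.
have := slope k0.
have : 0 < (1 - p) ^+ 3 by rewrite exprn_gt0// subr_gt0.
have := bern 0 1; have := bern 1 1; have := bern 2 1; have := bern 3 1.
have := bern 0 2; have := bern 1 2; have := bern 2 2; have := bern 3 2.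
have := bern 4 1; have := bern 4 2.
rewrite /N; lra.
Qed.

(** Divided by [N * B] this is [1 <= s / N] with [s = 1 - x * p ^+ 2 / (3 * B)], that is, [D32] is
    nonnegative. *)
Lemma NIF3_N_le : N * B <= B - x * p ^+ 2 / 3.
Proof.
have /andP[p0 p1] := p01.
have k0 : 0 <= p ^+ 3 * (p / 3 + 2 * p ^+ 3 / 9).
  by have := bern 4 0; have := bern 6 0; lra.
(* Here [k] covers only the negative part of the slope; the positive term [2 * x * p ^+ 4 / 9] is
   bounded below by 0. *)
have := slope k0; have : 0 <= x * p ^+ 4 by rewrite mulr_ge0 ?exprn_ge0 ?ltW.
have := bern 4 1; have := bern 5 1; have := bern 6 1; have := bern 6 2.
rewrite /N /B; lra.
Qed.

(** Divided by [N * B] this is [s / N - 1 <= B^-1], the upper bound for [D32 / x]. *)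
Lemma NIF3_le_N : B - x * p ^+ 2 / 3 <= N * (B + 1).
Proof.
have k0 : 0 <= p / 3 + 4 * p ^+ 3 / 9 - p ^+ 4 / 3 - 2 * p ^+ 6 / 9.
  have := bern 1 1; have := bern 2 1; have := bern 3 1; have := bern 3 0.
  by have := bern 4 1; have := bern 5 1; lra.
have := slope k0.
have := bern 0 8; have := bern 1 7; have := bern 2 6; have := bern 3 5.
have := bern 4 4; have := bern 5 3; have := bern 6 2; have := bern 7 1.
rewrite /N /B; lra.
Qed.

(** Divided by [A * B] this says that the numerator [t] in [D31 = x * (t / N - 1)] is
    nonnegative. *)
Lemma NIF3_row3_ge0 :
  0 <= A * B - 2 * x * p ^+ 4 / 9 * B - x * p ^+ 2 / 3 * A.
Proof.
have k0 : 0 <= 2 * p ^+ 3 * B / 9 + p * A / 3.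
  have /andP[p0 p1] := p01; rewrite /A /B.
  by rewrite addr_ge0 ?divr_ge0 ?mulr_ge0 ?exprn_ge0 ?subr_ge0 ?exprn_ile1 ?ltW.
have := slope k0.
have := bern 0 8; have := bern 1 7; have := bern 2 6; have := bern 3 5.
have := bern 4 4; have := bern 5 3; have := bern 6 2.
rewrite /A /B; lra.
Qed.

End NIF3Inequalities.

(** * The NIF3-Ralston scheme *)

Lemma NIF3_dissipation (R : realType) (z : R) : z < 0 ->
  [/\ is_trig_mx (NIF3_Ralston z), NIF3_Ralston z \in unitmx
    & forall v, 0 <= inner v (Defs.diffmx (@NIF3_Ralston R) z *m v)].
Proof.
move=> z0; have [e2 e3 e4 p01 xp] := expR_quarters z0.
set p := expR (z / 4) in e2 e3 e4 p01 xp.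
pose x := - z; have zx : z = - x by rewrite opprK.
have x0 : 0 < x by rewrite oppr_gt0.
rewrite -/x in xp; have xn0 : x != 0 by rewrite gt_eqF.
have zn0 : z != 0 by rewrite lt_eqF.
have N0 := NIF3_N_gt0 p01 xp; have F1 := NIF3_N_le p01 x0 xp.
have F2 := NIF3_le_N p01 xp; have F3 := NIF3_row3_ge0 p01 xp.
have /andP[p0 p1] := p01; have x0' := ltW x0; have p0' := ltW p0.
have pk k : 0 <= p ^+ k by rewrite exprn_ge0.
set N := 1 - p ^+ 4 - _ in N0 F1 F2.
set A := 1 - p ^+ 2 in F3; set B := 1 - p ^+ 3 in F1 F2 F3.
have A0 : 0 < A by rewrite subr_gt0 exprn_ilt1 ?ltW.
have BA : A <= B by rewrite lerB// exprS ler_piMl ?pk ?ltW.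
have B1 : B <= 1 by rewrite gerBl exprn_ge0 ?ltW.
have B0 : 0 < B by exact: lt_le_trans BA.
have N1 : N <= 1.
  rewrite /N -addrA gerDl -opprD oppr_le0 addr_ge0//.
  by rewrite mulr_ge0 ?addr_ge0 ?divr_ge0 ?mulr_ge0.
pose c := 2 * p ^+ 4 / 9; pose d := p ^+ 2 / 3.
have AE : NIF3_Ralston z = ralston_mx (A / x) (B / x) c d (N / x).
  rewrite /NIF3_Ralston e2 e3 e4 /ralston_mx.
  congr (mx_of_rows 3 [:: [:: _; 0; 0]; [:: 0; _; 0]; [:: c; d; _]]).
  - by rewrite zx /A; field.
  - by rewrite zx /B; field.
  - by rewrite zx /N; field.
have nz y : 0 < y -> y / x != 0.
  by move=> y0; rewrite mulf_neq0 ?invr_eq0 ?gt_eqF.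
rewrite AE; split; first exact: ralston_mx_trig.
  by rewrite ralston_mx_unit ?nz.
have [An0 Bn0 Nn0] : [/\ A != 0, B != 0 & N != 0] by rewrite !gt_eqF.
(* Up to the factor [x], [s / N] and [t / N] are the entries of [invmx (A z) *m Emx] in the last
   row, second and first column. *)
pose s := 1 - d * x / B; pose t := s - c * x / A.
have t0 : 0 <= t.
  rewrite (_ : t =
    (A * B - 2 * x * p ^+ 4 / 9 * B - x * p ^+ 2 / 3 * A) / (A * B)).
    by rewrite divr_ge0// mulr_ge0 ?ltW.
  by rewrite /t /s /c /d; field; rewrite An0 Bn0.
have ts : t <= s.
  by rewrite gerBl !(divr_ge0, mulr_ge0)// ltW.
have s1 : s <= 1.
  by rewrite gerBl !(divr_ge0, mulr_ge0)// ltW.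
have sB : s * B = B - x * p ^+ 2 / 3 by rewrite /s /d; field.
have sN : 1 <= s / N by rewrite ler_pdivlMr// mul1r -(ler_pM2r B0) sB.
have sN' : s / N - 1 <= B^-1.
  rewrite lerBlDr ler_pdivrMr// -(ler_pM2r B0) sB; apply: le_trans F2 _.
  by rewrite le_eqVlt; apply/orP; left; apply/eqP; field.
have tsN : t / N <= s / N by rewrite ler_pM2r// invr_gt0.
have tN0 : 0 <= t / N by rewrite divr_ge0// ltW.
have sN1 : s / N <= N^-1 by rewrite ler_piMl// invr_ge0 ltW.
have iB : 1 <= B^-1 by rewrite invf_ge1.
have iN : 1 <= N^-1 by rewrite invf_ge1.
have iBA : B^-1 <= A^-1 by rewrite lef_pV2.
have dom (u v w : R) : `|u| + `|v| <= 2 * w - 1 ->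
    `|x * u| + `|x * v| <= 2 * (x * w + z / 2).
  move=> h; rewrite !normrM (gtr0_norm x0) -mulrDr.
  by rewrite (_ : 2 * _ = x * (2 * w - 1)) ?ler_pM2l// zx; field.
have E21 : (B / x)^-1 + z = x * (B^-1 - 1).
  by rewrite zx; field; rewrite xn0 Bn0.
have E31 : (1 - c / (A / x) - d / (B / x)) / (N / x) + z = x * (t / N - 1).
  by rewrite zx /t /s; field; rewrite xn0 An0 Bn0 Nn0.
have E32 : (1 - d / (B / x)) / (N / x) + z = x * (s / N - 1).
  by rewrite zx /s; field; rewrite xn0 Bn0 Nn0.
have EV y : (y / x)^-1 = x * y^-1 by rewrite invf_div.
(* The sign of [t / N - 1] varies; from above it is controlled through [t <= s]. *)
have n31 w : s / N - 1 <= w -> 1 - t / N <= w -> `|t / N - 1| <= w.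
  by move=> *; rewrite ler_norml; lra.
(* The decisive bounds are [B^-1 <= A^-1] for the first row, [s / N - 1 <= B^-1] for the second and
   [t / N <= s / N <= N^-1] for the third. *)
apply: (ralston_diffmx_psd AE); rewrite ?nz// ?E21 ?E31 ?E32 EV; apply: dom.
- rewrite [`|B^-1 - 1|]ger0_norm ?subr_ge0// -lerBrDl; apply: n31; lra.
- by rewrite !ger0_norm ?subr_ge0//; lra.
- rewrite [`|s / N - 1|]ger0_norm ?subr_ge0// -lerBrDr.
  by rewrite ler_norml; lra.
Qed.

Unset Implicit Arguments.

Theorem theorem4p2 (R : realType) (M : nat) (Lh : 'M[R]_M) (G g : R -> R)
    (lg kappa tau : R)
    (hLh : spd Lh)
    (hG0 : forall v : R, 0 <= G v)
    (hGd : forall v : R, derivable G v 1)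
    (hg : forall v : R, g v = - (G^`()%classic v))
    (hlg : 0 < lg)
    (hlip : (lg.-lipschitz g)%type)
    (hkappa : 2 * lg <= kappa)
    (htau : 0 < tau) :
  preserves_dissipation (@TIF3_Ralston R) Lh G g kappa tau /\
  preserves_dissipation (@NIF3_Ralston R) Lh G g kappa tau.
Proof.
have Gle := Lipschitz_derivative_le hGd hg hlip.
have kappa0 : 0 <= kappa by apply: le_trans hkappa; rewrite mulr_ge0// ltW.
split; apply: (preserves_dissipation_of_psd _ _ _ hLh Gle kappa0 hkappa htau)
  => z z0.
- by case: (TIF3_dissipation z0).
- by case: (TIF3_dissipation z0).
- by case: (TIF3_dissipation z0).
- by case: (NIF3_dissipation z0).
- by case: (NIF3_dissipation z0).
- by case: (NIF3_dissipation z0).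
Qed.
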